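(* Let $(R,\mathfrak{m})$ be a commutative noetherian local ring. For an $R$-module $M$ consider the conditions (A) $\operatorname{Ass}(M)=\operatorname{Koatt}(M)$; (S) $\operatorname{Supp}(M)=V(\operatorname{Ann}_R(M))$; (B) $\operatorname{Ass}(M)$ has a finite final subset. Then: (1) For every $R$-module $M$, (S) holds if and only if every minimal prime divisor of $\operatorname{Ann}_R(M)$ belongs to $\operatorname{Ass}(M)$; moreover (A) implies (S), and (S) implies (B). (2) If all complete $R$-modules satisfy (B), then all complete $R$-modules satisfy (A). (3) All complete $R$-modules satisfy (S) if and only if all separated $R$-modules $M$ satisfy $\operatorname{Koatt}(M)\subset\operatorname{Ass}(\hat M)$.
   Context: An $R$-module $M$ is separated if $\bigcap_{n\ge1}\mathfrak{m}^nM=0$; $\hat M=\varprojlim M/\mathfrak{m}^nM$ is its $\mathfrak{m}$-adic completion, and $M$ is complete if the canonical map $M\to\hat M$ is an isomorphism. $\operatorname{Ass}(M)$ is the set of primes of $R$ associated to $M$; $\operatorname{Koatt}(M)$ is the set of primes $\mathfrak{p}$ of $R$ such that $\mathfrak{p}=\operatorname{Ann}_R(U)$ for some submodule $U\subset M$. $V(\mathfrak{a})$ is the set of primes containing the ideal $\mathfrak{a}$. A subset $F$ of a set $S$ of primes is final in $S$ if every $\mathfrak{p}\in S$ contains some $\mathfrak{q}\in F$. Modules need not be finitely generated. *)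

(* Defs.v *)
From HB Require Import structures.
From mathcomp Require Import all_boot all_algebra.
From mathcomp Require Import boolp classical_sets cardinality.
From mathcomp Require Import ring.

Set Implicit Arguments.
Unset Strict Implicit.
Unset Printing Implicit Defensive.

Import GRing.Theory.

Local Open Scope classical_set_scope.
Local Open Scope ring_scope.
Local Open Scope quotient_scope.

(* Submodules of [M] are terms of [submodClosed M]; ideals of [R], not         *)
(* necessarily proper, are the submodules of the regular module [R^o].         *)
(* MathComp's [idealr R] and [prime_idealr R] are proper by definition.  Sets  *)
(* of primes are terms of [set (set R)].                                       *)

Section Rings.
Variable R : comNzRingType.

Definition noetherian : Prop :=
  forall I : submodClosed R^o, exists (n : nat) (g : 'I_n -> R),
    forall x : R, x \in I <-> exists c : 'I_n -> R, x = \sum_i c i * g i.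

Definition maximal_ideal (m : idealr R) : Prop :=
  forall J : idealr R, [set` m] `<=` [set` J] -> [set` J] = [set` m].

Definition is_local (m : idealr R) : Prop :=
  maximal_ideal m /\
  forall n : idealr R, maximal_ideal n -> [set` n] = [set` m].

Definition is_prime (p : set R) : Prop :=
  exists P : prime_idealr R, p = [set` P].

(* [V(a)] *)
Definition Vset (a : set R) : set (set R) :=
  [set p | is_prime p /\ a `<=` p].

Definition minimal_prime_divisors (a : set R) : set (set R) :=
  [set p | Vset a p /\ forall q, Vset a q -> q `<=` p -> q = p].

Definition final_in (F S : set (set R)) : Prop :=
  F `<=` S /\ forall p, S p -> exists2 q, F q & q `<=` p.

End Rings.

Arguments noetherian : clear implicits.

(* [I N], the set of finite sums of products [a *: y], [a] in [I], [y] in [N]  *)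
Definition smulset (R : comNzRingType) (M : lmodType R)
    (I : set R) (N : set M) : set M :=
  [set x | exists (k : nat) (a : 'I_k -> R) (y : 'I_k -> M),
     [/\ forall i, I (a i), forall i, N (y i) & x = \sum_i a i *: y i]].

Section IdealPower.
Variables (R : comNzRingType) (I : set R).

Fixpoint ideal_pow (n : nat) : set R :=
  if n is n'.+1 then @smulset R R^o I (ideal_pow n') else setT.

Lemma ideal_powS n : ideal_pow n.+1 `<=` ideal_pow n.
Proof.
elim: n => [|n IHn] x; first by [].
move=> [k [a [y [Ia Iy ->]]]]; exists k, a, y.
by split; [exact: Ia | move=> i; move: (Iy i) => /IHn | ].
Qed.

End IdealPower.

Section QuotientModule.
Variables (R : comNzRingType) (M : lmodType R) (N : submodClosed M).

Definition submod_zmod : zmodClosed M :=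
  HB.pack_for (zmodClosed M) (GRing.SubmodClosed.sort N)
    (GRing.isZmodClosed.Build M (GRing.SubmodClosed.sort N)
       (GRing.submod_closedB (submodClosedP N))).

Definition quotmod := Quotient.quot submod_zmod.

HB.instance Definition _ := GRing.Zmodule.on quotmod.
HB.instance Definition _ :=
  EqQuotient.copy quotmod (Quotient.quot submod_zmod).

Lemma quotmod_eqE (x y : M) : (\pi_quotmod x == \pi_quotmod y) = (x - y \in N).
Proof. by rewrite -(Quotient.idealrBE submod_zmod). Qed.

Lemma quotmod_piD (x y : M) :
  \pi_quotmod (x + y) = \pi_quotmod x + \pi_quotmod y.
Proof. exact: (Quotient.pi_add submod_zmod). Qed.

Definition quotmod_scale (a : R) := lift_op1 quotmod ( *:%R a).

Lemma quotmod_piZ (a : R) (x : M) :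
  \pi_quotmod (a *: x) = quotmod_scale a (\pi_quotmod x).
Proof.
unlock quotmod_scale; apply/eqP; rewrite quotmod_eqE -scalerBr; apply: rpredZ.
by rewrite -quotmod_eqE reprK.
Qed.

Lemma quotmod_scaleA a b x :
  quotmod_scale a (quotmod_scale b x) = quotmod_scale (a * b) x.
Proof. by rewrite -[x]reprK; rewrite -!quotmod_piZ scalerA. Qed.

Lemma quotmod_scale1 : left_id 1 quotmod_scale.
Proof. by move=> x; rewrite -[x]reprK; rewrite -quotmod_piZ scale1r. Qed.

Lemma quotmod_scaleDr : right_distributive quotmod_scale +%R.
Proof.
move=> a x y; rewrite -[x]reprK; rewrite -[y]reprK.
by rewrite -quotmod_piD -!quotmod_piZ -quotmod_piD scalerDr.
Qed.

Lemma quotmod_scaleDl x : {morph quotmod_scale^~ x : a b / a + b}.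
Proof.
by move=> a b; rewrite -[x]reprK; rewrite -!quotmod_piZ -quotmod_piD scalerDl.
Qed.

HB.instance Definition _ := GRing.Zmodule_isLmodule.Build R quotmod
  quotmod_scaleA quotmod_scale1 quotmod_scaleDr quotmod_scaleDl.

Lemma quotmod_pi_linear : linear \pi_quotmod.
Proof. by move=> a x y; rewrite quotmod_piD quotmod_piZ. Qed.

End QuotientModule.

Section Completion.
Variables (R : comNzRingType) (I : set R) (M : lmodType R).

(* [I^n M] *)
Definition adic (n : nat) : {pred M} :=
  fun x => `[< smulset (ideal_pow I n) [set: M] x >].

Lemma adicP n x :
  reflect (smulset (ideal_pow I n) [set: M] x) (x \in adic n).
Proof. exact: asboolP. Qed.

Lemma adic_submod_closed n : submod_closed (adic n).
Proof.
split=> [|c u v /adicP[k [a [y [Ia _ ->]]]] /adicP[l [b [z [Ib _ ->]]]]].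
  apply/adicP; exists 0%N, (fun=> 0), (fun=> 0).
  by split=> [[] | |] //; rewrite big_ord0.
apply/adicP; exists (k + l)%N,
  (fun i => match split i with inl j => a j | inr j => b j end),
  (fun i => match split i with inl j => c *: y j | inr j => z j end).
split=> // [i|]; first by case: (split i).
rewrite big_split_ord /= scaler_sumr; congr (_ + _).
  apply: eq_bigr => i _; case: splitP => j /=; last first.
    by move=> eqij; have := ltn_ord i; rewrite eqij ltnNge leq_addr.
  by move/ord_inj->; rewrite !scalerA mulrC.
apply: eq_bigr => i _; case: splitP => j /=.
  by move=> eqij; have := ltn_ord j; rewrite -eqij ltnNge leq_addr.
by move/addnI/ord_inj->.
Qed.

HB.instance Definition _ n :=
  GRing.isSubmodClosed.Build R M (adic n) (adic_submod_closed n).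

Lemma adicS n : {subset adic n.+1 <= adic n}.
Proof.
move=> x /adicP[k [a [y [Ia _ ->]]]]; apply/adicP; exists k, a, y.
by split=> // i; apply: ideal_powS.
Qed.

(* [M / I^n M] *)
Definition adic_quot (n : nat) := quotmod (adic n).
HB.instance Definition _ n := GRing.Lmodule.on (adic_quot n).
HB.instance Definition _ n := EqQuotient.copy (adic_quot n) (quotmod (adic n)).

(* The transition map; [adic_trans_pi] shows that the choice of               *)
(* representative does not matter.                                             *)
Definition adic_trans (n : nat) (x : adic_quot n.+1) : adic_quot n :=
  \pi_(adic_quot n) (repr x).

Lemma adic_trans_pi n (x : M) :
  adic_trans (\pi_(adic_quot n.+1) x) = \pi_(adic_quot n) x.
Proof.
apply/eqP; rewrite quotmod_eqE; apply: adicS.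
by rewrite -quotmod_eqE reprK.
Qed.

Lemma adic_trans_linear n : linear (@adic_trans n).
Proof.
move=> a x y; rewrite -[x]reprK; rewrite -[y]reprK.
by rewrite -quotmod_pi_linear !adic_trans_pi quotmod_pi_linear.
Qed.

(* The product of the [M / I^n M]; the factor [n = 0] is zero.                 *)
Definition adic_prod := forall n : nat, adic_quot n.
HB.instance Definition _ := gen_eqMixin adic_prod.
HB.instance Definition _ := gen_choiceMixin adic_prod.

Definition prod_add (f g : adic_prod) : adic_prod := fun n => f n + g n.
Definition prod_opp (f : adic_prod) : adic_prod := fun n => - f n.
Definition prod_scale (a : R) (f : adic_prod) : adic_prod := fun n => a *: f n.

Lemma prod_addA : associative prod_add.
Proof. by move=> f g h; apply: functional_extensionality_dep => n; apply: addrA. Qed.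
Lemma prod_addC : commutative prod_add.
Proof. by move=> f g; apply: functional_extensionality_dep => n; apply: addrC. Qed.
Lemma prod_add0 : left_id ((fun=> 0) : adic_prod) prod_add.
Proof. by move=> f; apply: functional_extensionality_dep => n; apply: add0r. Qed.
Lemma prod_addN : left_inverse ((fun=> 0) : adic_prod) prod_opp prod_add.
Proof. by move=> f; apply: functional_extensionality_dep => n; apply: addNr. Qed.
HB.instance Definition _ :=
  GRing.isZmodule.Build adic_prod prod_addA prod_addC prod_add0 prod_addN.

Lemma prod_scaleA a b f : prod_scale a (prod_scale b f) = prod_scale (a * b) f.
Proof. by apply: functional_extensionality_dep => n; apply: scalerA. Qed.
Lemma prod_scale1 : left_id 1 prod_scale.
Proof. by move=> f; apply: functional_extensionality_dep => n; apply: scale1r. Qed.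
Lemma prod_scaleDr : right_distributive prod_scale +%R.
Proof. by move=> a f g; apply: functional_extensionality_dep => n; apply: scalerDr. Qed.
Lemma prod_scaleDl f : {morph prod_scale^~ f : a b / a + b}.
Proof. by move=> a b; apply: functional_extensionality_dep => n; apply: scalerDl. Qed.
HB.instance Definition _ := GRing.Zmodule_isLmodule.Build R adic_prod
  prod_scaleA prod_scale1 prod_scaleDr prod_scaleDl.

Definition adic_compatible : {pred adic_prod} :=
  fun f => `[< forall n, adic_trans (f n.+1) = f n >].

Lemma adic_compatible_submod : submod_closed adic_compatible.
Proof.
have trans0 n : @adic_trans n 0 = 0.
  have := @adic_trans_linear n (-1) 0 0.
  by rewrite scaler0 addr0 scaleN1r addNr.
split=> [|a f g /asboolP fP /asboolP gP]; apply/asboolP => n.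
  exact: trans0.
have := @adic_trans_linear n a (f n.+1) (g n.+1).
by rewrite fP gP.
Qed.

HB.instance Definition _ := GRing.isSubmodClosed.Build R adic_prod
  adic_compatible adic_compatible_submod.

(* The inverse limit of the [M / I^n M]: compatibility with the consecutive    *)
(* transition maps gives compatibility with all of them.                       *)
Definition completion := {f : adic_prod | f \in adic_compatible}.
HB.instance Definition _ := Choice.on completion.
HB.instance Definition _ := SubChoice.on completion.
HB.instance Definition _ := [SubChoice_isSubLmodule of completion by <:].

Lemma to_completion_subproof (x : M) :
  ((fun n => \pi_(adic_quot n) x) : adic_prod) \in adic_compatible.
Proof. by apply/asboolP => n; rewrite adic_trans_pi. Qed.

Definition to_completion (x : M) : completion :=
  exist (fun f => f \in adic_compatible) _ (to_completion_subproof x).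

Lemma to_completion_linear : linear to_completion.
Proof.
move=> a x y; apply/val_inj/functional_extensionality_dep => n /=.
by rewrite quotmod_pi_linear.
Qed.

HB.instance Definition _ :=
  GRing.isLinear.Build R M completion _ to_completion to_completion_linear.

Definition separated : Prop :=
  \bigcap_(n in [set n | (0 < n)%N]) [set` adic n] = [set 0].

(* [to_completion] is linear, so it is an isomorphism as soon as it is         *)
(* bijective.                                                                  *)
Definition complete : Prop := bijective to_completion.

End Completion.

Section Localization.
Variables (R : comNzRingType) (p : prime_idealr R) (M : lmodType R).

Definition denominator := {s : R | s \notin p}.

Lemma denominator1_subproof : (1 : R) \notin p.
Proof. by rewrite idealr1. Qed.
Definition denominator1 : denominator := exist (fun u => u \notin p) 1 denominator1_subproof.

Lemma denominatorM_subproof (s t : denominator) : sval s * sval t \notin p.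
Proof. by rewrite prime_idealrM negb_or (valP s) (valP t). Qed.
Definition denominatorM (s t : denominator) : denominator :=
  exist (fun u => u \notin p) _ (denominatorM_subproof s t).

(* [(x, s)] stands for the fraction [x / s] *)
Definition fraction := (M * denominator)%type.

Definition frac_equiv (f g : fraction) : bool :=
  `[< exists u : denominator,
        sval u *: (sval g.2 *: f.1 - sval f.2 *: g.1) = 0 >].

Lemma frac_equiv_refl : reflexive frac_equiv.
Proof.
by move=> f; apply/asboolP; exists denominator1; rewrite subrr scaler0.
Qed.

Lemma frac_equiv_sym : symmetric frac_equiv.
Proof.
by move=> f g; apply/asboolP/asboolP => -[u uP]; exists u;
  rewrite -opprB scalerN uP oppr0.
Qed.

Lemma frac_equiv_trans : transitive frac_equiv.
Proof.
move=> [y t] [x s] [z r] /asboolP[u /= uP] /asboolP[v /= vP]; apply/asboolP.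
exists (denominatorM t (denominatorM u v)) => /=.
have : (sval v * sval r) *: (sval u *: (sval t *: x - sval s *: y)) +
       (sval u * sval s) *: (sval v *: (sval r *: y - sval t *: z)) = 0.
  by rewrite uP vP !scaler0 addr0.
rewrite !scalerBr !scalerA.
rewrite (_ : sval u * sval s * sval v * sval r = sval v * sval r * sval u * sval s);
  last by ring.
rewrite addrA subrK => <-; congr (_ *: _ - _ *: _); ring.
Qed.

Canonical frac_equiv_equiv :=
  EquivRel frac_equiv frac_equiv_refl frac_equiv_sym frac_equiv_trans.

(* [M_p] *)
Definition localization := {eq_quot frac_equiv}.
HB.instance Definition _ : EqQuotient fraction frac_equiv localization :=
  EqQuotient.on localization.
HB.instance Definition _ := Choice.on localization.

Local Notation pi := (\pi_localization).

Lemma pi_fracP (f g : fraction) : reflect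
  (exists u : denominator,
     sval u *: (sval g.2 *: f.1 - sval f.2 *: g.1) = 0) (pi f == pi g).
Proof. by rewrite piE; apply: asboolP. Qed.

Definition frac_zero : fraction := (0, denominator1).
Definition frac_opp (f : fraction) : fraction := (- f.1, f.2).
Definition frac_add (f g : fraction) : fraction :=
  (sval g.2 *: f.1 + sval f.2 *: g.1, denominatorM f.2 g.2).
Definition frac_scale (a : R) (f : fraction) : fraction := (a *: f.1, f.2).

Definition loc_zero := lift_cst localization frac_zero.
Definition loc_opp := lift_op1 localization frac_opp.
Definition loc_add := lift_op2 localization frac_add.
Definition loc_scale (a : R) := lift_op1 localization (frac_scale a).

Lemma loc_pi0 : pi frac_zero = loc_zero.
Proof. by unlock loc_zero. Qed.

Lemma loc_piN f : pi (frac_opp f) = loc_opp (pi f).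
Proof.
unlock loc_opp; apply/eqP/pi_fracP.
have /eqP/pi_fracP[u uP] := esym (reprK (pi f)); exists u => /=.
by rewrite !scalerN -opprD scalerN uP oppr0.
Qed.

Lemma loc_piZ a f : pi (frac_scale a f) = loc_scale a (pi f).
Proof.
unlock loc_scale; apply/eqP/pi_fracP.
have /eqP/pi_fracP[u uP] := esym (reprK (pi f)); exists u => /=.
rewrite ![_ *: (a *: _)]scalerA ![_ * a]mulrC -!scalerA -scalerBr.
by rewrite scalerA mulrC -scalerA uP scaler0.
Qed.

Lemma loc_piD f g : pi (frac_add f g) = loc_add (pi f) (pi g).
Proof.
unlock loc_add; apply/eqP/pi_fracP.
have /eqP/pi_fracP[] := esym (reprK (pi f)).
have /eqP/pi_fracP[] := esym (reprK (pi g)).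
move: (repr _) (repr _) => [x' s'] [y' t'] v /= vP u uP.
case: f g => [x s] [y t] /= in uP vP *.
exists (denominatorM u v) => /=.
have : (sval v * sval t * sval t') *: (sval u *: (sval s' *: x - sval s *: x')) +
       (sval u * sval s * sval s') *: (sval v *: (sval t' *: y - sval t *: y')) = 0.
  by rewrite uP vP !scaler0 addr0.
rewrite !(scalerDr, scalerBr) !(scalerN, scalerA) => eq0.
rewrite scalerDr !scalerA -[RHS]eq0 opprD [LHS]addrACA.
by congr (_ + _); congr (_ - _); congr (_ *: _); ring.
Qed.

Lemma loc_addA : associative loc_add.
Proof.
move=> x y z; rewrite -[x]reprK -[y]reprK -[z]reprK -!loc_piD.
move: (repr x) (repr y) (repr z) => [m1 s1] [m2 s2] [m3 s3].
apply/eqP/pi_fracP; exists denominator1 => /=.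
rewrite !scalerDr !scalerA addrA; apply/eqP; rewrite scale1r subr_eq0; apply/eqP.
by congr (_ + _ + _); congr (_ *: _); ring.
Qed.

Lemma loc_addC : commutative loc_add.
Proof.
move=> x y; rewrite -[x]reprK -[y]reprK -!loc_piD.
apply/eqP/pi_fracP; exists denominator1 => /=.
apply/eqP; rewrite scale1r subr_eq0; apply/eqP.
by congr (_ *: _); [ring | exact: addrC].
Qed.

Lemma loc_add0 : left_id loc_zero loc_add.
Proof.
move=> x; rewrite -[x]reprK -loc_pi0 -loc_piD.
apply/eqP/pi_fracP; exists denominator1 => /=.
by rewrite scaler0 add0r !scale1r mul1r subrr.
Qed.

Lemma loc_addN : left_inverse loc_zero loc_opp loc_add.
Proof.
move=> x; rewrite -[x]reprK -loc_pi0 -loc_piN -loc_piD.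
apply/eqP/pi_fracP; exists denominator1 => /=.
by rewrite scalerN addNr !scaler0 subrr scaler0.
Qed.

HB.instance Definition _ :=
  GRing.isZmodule.Build localization loc_addA loc_addC loc_add0 loc_addN.

Lemma loc_scaleA a b x : loc_scale a (loc_scale b x) = loc_scale (a * b) x.
Proof. by rewrite -[x]reprK -!loc_piZ /frac_scale /= scalerA. Qed.

Lemma loc_scale1 : left_id 1 loc_scale.
Proof.
move=> x; rewrite -[x]reprK -loc_piZ /frac_scale scale1r.
by rewrite -surjective_pairing.
Qed.

Lemma loc_scaleDr : right_distributive loc_scale +%R.
Proof.
move=> a x y; rewrite -[x]reprK -[y]reprK -[X in loc_scale a X]loc_piD -!loc_piZ.
rewrite -[RHS]loc_piD; congr (pi (_, _)).
by rewrite /= scalerDr !scalerA mulrC [a * sval (repr x).2]mulrC.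
Qed.

Lemma loc_scaleDl x : {morph loc_scale^~ x : a b / a + b}.
Proof.
move=> a b; rewrite -[x]reprK -!loc_piZ -[RHS]loc_piD.
apply/eqP/pi_fracP; exists denominator1 => /=.
rewrite scale1r -scalerDr -scalerDl !scalerA; apply/eqP.
by rewrite subr_eq0; apply/eqP; congr (_ *: _); ring.
Qed.

HB.instance Definition _ := GRing.Zmodule_isLmodule.Build R localization
  loc_scaleA loc_scale1 loc_scaleDr loc_scaleDl.

End Localization.

Section Primes.
Variables (R : comNzRingType) (M : lmodType R).

Definition Ann (A : set M) : set R := [set r | forall x, A x -> r *: x = 0].

Definition Ass : set (set R) :=
  [set p | is_prime p /\ exists x : M, p = Ann [set x]].

Definition Koatt : set (set R) :=
  [set p | is_prime p /\ exists U : submodClosed M, p = Ann [set` U]].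

Definition Supp : set (set R) :=
  [set p | exists P : prime_idealr R,
     p = [set` P] /\ exists z : localization P M, z != 0].

Definition condA : Prop := Ass = Koatt.
Definition condS : Prop := Supp = Vset (Ann [set: M]).
Definition condB : Prop := exists F, finite_set F /\ final_in F Ass.

End Primes.

Arguments Ann {R M} A.
Arguments Ass {R} M.
Arguments Koatt {R} M.
Arguments Supp {R} M.
Arguments condA {R} M.
Arguments condS {R} M.
Arguments condB {R} M.
Arguments completion {R} I M.
Arguments separated {R} I M.
Arguments complete {R} I M.

(* Main.v *)
Require Import Defs.
From HB Require Import structures.
From mathcomp Require Import all_boot all_algebra.
From mathcomp Require Import boolp classical_sets cardinality.
From mathcomp Require Import ring.

Set Implicit Arguments.
Unset Strict Implicit.
Unset Printing Implicit Defensive.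

Import GRing.Theory.

Local Open Scope classical_set_scope.
Local Open Scope ring_scope.
Local Open Scope quotient_scope.

(** The link between the conditions is [Ass_below]: if a prime [p] contains
    [Ann x], then some multiple of [x] has a prime annihilator contained in
    [p].  Hence [p] lies in the support of [M] exactly when it contains an
    associated prime, and (S) amounts to all minimal prime divisors of
    [Ann M] being associated ([condSP]).  Such a divisor has the form
    [(Ann M : c) = Ann (c M)], so it lies in [Koatt M], and (A) implies (S).
    There are finitely many of them, because an ideal of a noetherian ring
    contains a finite product of primes that contain it; so (S) implies (B).

    For a complete module (B) implies (S) ([complete_condB_condS]).  Let
    [q_1, ..., q_r] be final in [Ass M], and let [p] be a minimal prime divisor
    of [Ann M] containing no [q_i].  Some [c] outside [p] lies in every [q_i];
    every prime over [Ann x] contains some [q_i], so every [x] is killed by a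
    power of [c].  By the argument of Baire's theorem, [c^n m^k M = 0] for some
    [n] and [k].  Therefore [m^k] lies in [p], so [p = m]; but [m] contains an
    associated prime as soon as [M] is nonzero, and that prime is [p] by
    minimality.

    The last ingredient is that a closed submodule [N] of a complete module is
    complete for its own [m]-adic topology ([complete_of_coarser]): [m] being
    finitely generated, a convergent series whose terms lie in [m^k N] can be
    regrouped as a finite combination of products of [k] generators, with
    convergent series of elements of [N] as coefficients.  Let [M] be separated
    and let [p = Ann U] be a prime in [Koatt M].  The elements of the completion
    of [M] killed by [p] form a closed submodule [N] that contains [U], so
    [N] is complete and [Ann N = p].  Applied to [N], condition (S) gives [p]
    in [Ass N], hence in [Ass] of the completion: this is one half of (3), and
    with the previous paragraph it gives (2).  The other half of (3) holds
    because minimal prime divisors of [Ann M] lie in [Koatt M]. *)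

(** * Ideals of a noetherian ring *)

Section Ideals.
Variable R : comNzRingType.
Implicit Types (I J p q : set R) (a b c : R).

(** Unlike [idealr], this includes the whole ring. *)
Record ideal I : Prop := Ideal {
  ideal0 : I 0;
  idealD : forall a b, I a -> I b -> I (a + b);
  idealZ : forall c a, I a -> I (c * a) }.

Lemma ideal_sum I : ideal I -> forall n (a : 'I_n -> R),
  (forall i, I (a i)) -> I (\sum_i a i).
Proof.
move=> idI n a Ia.
by apply: big_ind => //; [exact: ideal0|exact: idealD].
Qed.

Definition mem_set_pred I : {pred R^o} := fun x => `[< I x >].

Lemma mem_set_predE I x : (x \in mem_set_pred I) <-> I x.
Proof. by split=> /asboolP. Qed.

Lemma ideal_submod I : ideal I -> submod_closed (mem_set_pred I).
Proof.
move=> idI; split=> [|c a b /asboolP Ia /asboolP Ib]; apply/asboolP.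
  exact: ideal0.
by apply: idealD => //; apply: idealZ.
Qed.

Definition submod_of_ideal I (idI : ideal I) : submodClosed R^o :=
  HB.pack_for (submodClosed R^o) (mem_set_pred I)
    (GRing.isSubmodClosed.Build R R^o (mem_set_pred I) (ideal_submod idI)).

Lemma idealr_ideal (P : idealr R) : ideal [set` P].
Proof.
by split=> /= [|a b|c a]; [exact: idealr0|exact: rpredD|exact: idealMr].
Qed.

Lemma idealr_of I : ideal I -> ~ I 1 -> exists P : idealr R, I = [set` P].
Proof.
move=> idI nI1.
have cl : idealr_closed (mem_set_pred I : {pred R}).
  split=> [||c a b /asboolP Ia /asboolP Ib].
  - by apply/asboolP; apply: ideal0.
  - by apply/asboolP.
  - by apply/asboolP; apply: idealD => //; apply: idealZ.
pose P : idealr R := HB.pack_for (idealr R) (mem_set_pred I)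
    (isIdealr.Build R (mem_set_pred I) cl).
by exists P; apply/seteqP; split=> x /=; move/mem_set_predE.
Qed.

Lemma is_primeP p : is_prime p <->
  [/\ ideal p, ~ p 1 & forall a b, p (a * b) -> p a \/ p b].
Proof.
split=> [[P ->]|[idp np1 pM]].
  split=> /= [||a b]; first exact: idealr_ideal.
    by rewrite idealr1.
  by rewrite prime_idealrM => /orP.
have cl : idealr_closed (mem_set_pred p : {pred R}).
  split=> [||c a b /asboolP Ia /asboolP Ib].
  - by apply/asboolP; apply: ideal0.
  - by apply/asboolP.
  - by apply/asboolP; apply: idealD => //; apply: idealZ.
have prcl : prime_idealr_closed (mem_set_pred p : {pred R}).
  move=> a b /asboolP/pM[] pab; apply/orP; [left|right]; exact/asboolP.
pose P : prime_idealr R := HB.pack_for (prime_idealr R) (mem_set_pred p)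
    (isIdealr.Build R (mem_set_pred p) cl)
    (isPrimeIdealrClosed.Build R (mem_set_pred p) prcl).
by exists P; apply/seteqP; split=> x /=; move/mem_set_predE.
Qed.

Lemma prime_ideal p : is_prime p -> ideal p.
Proof. by case/is_primeP. Qed.

Lemma primeX p c n : is_prime p -> p (c ^+ n) -> p c.
Proof.
move=> /is_primeP[_ np1 pM]; elim: n => [|n IHn]; first by rewrite expr0.
by rewrite exprS => /pM[].
Qed.

Lemma ideal_colon I c : ideal I -> ideal [set a | I (a * c)].
Proof.
move=> idI; split=> /= [|a b Ia Ib|d a Ia].
- by rewrite mul0r; apply: ideal0.
- by rewrite mulrDl; apply: idealD.
- by rewrite -mulrA; apply: idealZ.
Qed.

Definition ideal_adjoin I c : set R :=
  [set x | exists a b, I a /\ x = a + b * c].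

Lemma ideal_adjoin_ideal I c : ideal I -> ideal (ideal_adjoin I c).
Proof.
move=> idI; split=> /= [|_ _ [a [b [Ia ->]]] [a' [b' [Ia' ->]]]
  |d _ [a [b [Ia ->]]]].
- by exists 0, 0; split; [exact: ideal0|ring].
- by exists (a + a'), (b + b'); split; [exact: idealD|ring].
- by exists (d * a), (d * b); split; [exact: idealZ|ring].
Qed.

Lemma sub_ideal_adjoin I c : I `<=` ideal_adjoin I c.
Proof. by move=> a Ia; exists a, 0; split=> //; ring. Qed.

Lemma mem_ideal_adjoin I c : ideal I -> ideal_adjoin I c c.
Proof. by move=> idI; exists 0, 1; split; [exact: ideal0|ring]. Qed.

Section Noetherian.
Hypothesis noethR : noetherian R.

Lemma noetherian_fg I : ideal I -> exists (n : nat) (g : 'I_n -> R),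
  forall x, I x <-> exists c : 'I_n -> R, x = \sum_i c i * g i.
Proof.
move=> idI; have [n [g gP]] := noethR (submod_of_ideal idI).
exists n, g => x; rewrite -gP; split=> [Ix|]; first exact/asboolP.
by move/asboolP.
Qed.

(** Maximum principle: without a maximal element, dependent choice gives a
    strictly increasing chain in [S], and its union is finitely generated, so
    it is reached at a finite stage. *)
Lemma noetherian_max (S : set (set R)) :
  (forall I, S I -> ideal I) -> S !=set0 ->
  exists2 I, S I & forall J, S J -> I `<=` J -> J `<=` I.
Proof.
move=> idS [I0 SI0]; apply: contrapT => nomax.
have /choice[f fP] : forall I : {I | S I}, exists J : {J | S J},
    sval I `<=` sval J /\ ~ sval J `<=` sval I.
  move=> [I SI]; apply: contrapT => noJ; apply: nomax; exists I => // J SJ IJ.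
  by apply: contrapT => nJI; apply: noJ; exists (exist _ J SJ).
pose s n := sval (iter n f (exist _ I0 SI0)).
have Ss n : S (s n) by apply: svalP.
have sS n : s n `<=` s n.+1 by case: (fP (iter n f (exist _ I0 SI0))).
have nsS n : ~ s n.+1 `<=` s n by case: (fP (iter n f (exist _ I0 SI0))).
have smono n k : (n <= k)%N -> s n `<=` s k.
  move=> /subnK <-; elim: (k - n)%N => // d IHd x /IHd.
  by rewrite addSn; apply: sS.
pose U : set R := [set x | exists n, s n x].
have idU : ideal U.
  split=> [|a b [n sa] [k sb]|c a [n sa]].
  - by exists 0%N; apply: ideal0; apply: idS.
  - exists (maxn n k); apply: idealD; first exact: idS.
    + by apply: smono sa; apply: leq_maxl.
    + by apply: smono sb; apply: leq_maxr.
  - by exists n; apply: idealZ => //; apply: idS.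
have [n [g gP]] := noetherian_fg idU.
have Ug i : exists k, s k (g i).
  apply: (iffRL (gP (g i))); exists (fun j => (j == i)%:R).
  rewrite (bigD1 i) //= eqxx mul1r big1 ?addr0 // => j /negPf->.
  by rewrite mul0r.
have [k kP] := choice Ug.
have [N NP] : exists N, forall i, (k i <= N)%N.
  by exists (\max_i k i) => i; apply: leq_bigmax.
apply: (nsS N) => x sx.
have /gP[c ->] : U x by exists N.+1.
apply: ideal_sum => [|i]; first exact: idS.
by apply: idealZ; [exact: idS|apply: smono (kP i); exact: NP].
Qed.

End Noetherian.
End Ideals.

(** * Primes over an ideal *)

Section NoetherianPrimes.
Variable R : comNzRingType.
Implicit Types (I J p q : set R) (a b c : R) (Ps Qs : seq (set R)).
Hypothesis noethR : noetherian R.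

(** A maximal element among the ideals [(I : c)] contained in [p] is prime. If
    [ab] is in [(I : c)] and [(I : ac)] is contained in [p], then maximality
    puts [b] in [(I : c)]; otherwise some [d] outside [p] multiplies [ac] into
    [I], and maximality against [(I : dc)] puts [a] in [(I : c)]. *)
Lemma colon_prime I p : ideal I -> is_prime p -> I `<=` p ->
  exists c, [/\ is_prime [set a | I (a * c)] & [set a | I (a * c)] `<=` p].
Proof.
move=> idI prp Ip; have [idp np1 pM] := (is_primeP p).1 prp.
pose S : set (set R) :=
  [set J | exists2 c, J = [set a | I (a * c)] & J `<=` p].
have idS J : S J -> ideal J by move=> [c -> _]; apply: ideal_colon.
have S0 : S !=set0.
  exists [set a | I (a * 1)]; exists 1 => // a /=; rewrite mulr1; exact: Ip.
have [_ [c -> cp] maxc] := noetherian_max noethR idS S0.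
exists c; split=> //; apply/is_primeP; split=> [||a b /= Iab].
- exact: ideal_colon.
- by move=> /= I1; apply/np1/cp.
- apply: contrapT => /not_orP[nIa nIb].
  have [acp|] := pselect ([set x | I (x * (a * c))] `<=` p).
    apply: nIb; apply: (maxc [set x | I (x * (a * c))]).
    + by exists (a * c).
    + by move=> x /= Ixc; rewrite mulrCA; apply: idealZ.
    + by rewrite /= mulrA [b * a]mulrC.
  move=> /existsNP[d /not_implyP[/= Idac npd]]; apply: nIa.
  apply: (maxc [set x | I (x * (d * c))]).
  - exists (d * c) => // x /= Ixdc.
    by have /cp/pM[] : I ((x * d) * c) by rewrite -mulrA.
  - by move=> x /= Ixc; rewrite mulrCA; apply: idealZ.
  - by rewrite /= mulrCA.
Qed.

(** One factor is taken from each ideal of the list: these products generate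
    the product ideal, and an ideal contains the former iff it contains the
    latter. *)
Fixpoint prime_products Ps : set R :=
  if Ps is P :: Qs then
    [set c | exists a b, [/\ P a, prime_products Qs b & c = a * b]]
  else [set 1].

Lemma prime_products_cat Ps Qs c : prime_products (Ps ++ Qs) c ->
  exists a b, [/\ prime_products Ps a, prime_products Qs b & c = a * b].
Proof.
elim: Ps c => [|P Ps IHPs] c /=; first by move=> Qc; exists 1, c; rewrite mul1r.
move=> [a [_ [Pa /IHPs[b [d [Psb Qd ->]]] ->]]].
by exists (a * b), d; split=> //; [exists a, b|rewrite mulrA].
Qed.

Lemma sub_prime_products Ps p : is_prime p -> prime_products Ps `<=` p ->
  exists2 P, P \in Ps & P `<=` p.
Proof.
move=> /is_primeP[_ np1 pM]; elim: Ps => [|P Ps IHPs] /= Psp.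
  by case: np1; apply: Psp.
have [Pp|] := pselect (P `<=` p); first by exists P => //; rewrite inE eqxx.
move=> /existsNP[a /not_implyP[Pa npa]].
have [|Q Qin Qp] := IHPs; last by exists Q => //; rewrite inE Qin orbT.
by move=> b Psb; have /pM[] : p (a * b) by apply: Psp; exists a, b.
Qed.

(** Noetherian induction: for a maximal counterexample [J], which is neither
    the whole ring nor prime, take [ab] in [J] with [a], [b] outside [J]; the
    product of [J + (a)] and [J + (b)] is contained in [J]. *)
Lemma exists_prime_products I : ideal I -> exists Ps,
  (forall P, P \in Ps -> Vset I P) /\ prime_products Ps `<=` I.
Proof.
pose good J := exists Ps,
  (forall P, P \in Ps -> Vset J P) /\ prime_products Ps `<=` J.
move=> idI; apply: contrapT => nI.
have [J [idJ nJ] maxJ] := @noetherian_max R noethR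
  [set J | ideal J /\ ~ good J] (fun J => @proj1 _ _)
  (ex_intro _ I (conj idI nI)).
have nJ1 : ~ J 1 by move=> J1; apply: nJ; exists [::]; split=> // _ ->.
have good_adjoin c : ~ J c -> good (ideal_adjoin J c).
  move=> nJc; apply: contrapT => ngood; apply: nJc.
  apply: (maxJ (ideal_adjoin J c)).
  - by split=> //; apply: ideal_adjoin_ideal.
  - exact: sub_ideal_adjoin.
  - exact: mem_ideal_adjoin.
apply: nJ; have [prJ|nprJ] := pselect (is_prime J).
  exists [:: J]; split=> [P|_ [a [_ [Ja -> ->]]]]; last by rewrite mulr1.
  by rewrite inE => /eqP->; split.
have [a [b [Jab nJa nJb]]] : exists a b, [/\ J (a * b), ~ J a & ~ J b].
  apply: contrapT => nab; apply/nprJ/is_primeP; split=> // a b Jab.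
  by apply: contrapT => /not_orP[nJa nJb]; apply: nab; exists a, b.
have [Ps [VPs PsJ]] := good_adjoin a nJa.
have [Qs [VQs QsJ]] := good_adjoin b nJb.
have sub c P : Vset (ideal_adjoin J c) P -> Vset J P.
  by move=> [prP cP]; split=> // x Jx; apply/cP/sub_ideal_adjoin.
exists (Ps ++ Qs); split=> [P|c].
  by rewrite mem_cat => /orP[/VPs|/VQs]; apply: sub.
move=> /prime_products_cat[x [y [/PsJ[u [v [Ju ->]]] /QsJ[w [z [Jw ->]]] ->]]].
rewrite (_ : _ * _ = (w + z * b) * u + (v * a) * w + (v * z) * (a * b));
  last by ring.
by do 2?apply: idealD => //; apply: idealZ.
Qed.

(** Induction on [s]: if the head of [s] is contained in the set found for the
    tail, search the tail again, from the head on. *)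
Lemma minimal_below (s : seq (set R)) p :
  exists q, [/\ q = p \/ q \in s, q `<=` p &
    forall r, r \in s -> r `<=` q -> r = q].
Proof.
elim: s p => [|x s IHs] p; first by exists p; split=> //; left.
have [q [qin qp qmin]] := IHs p.
have [xq|nxq] := pselect (x `<=` q); last first.
  exists q; split=> // [|r].
    by case: qin; [left|rewrite inE => ->; rewrite orbT; right].
  by rewrite inE => /orP[/eqP->|/qmin].
have [q' [q'in q'x q'min]] := IHs x.
exists q'; split=> [||r].
- by right; rewrite inE; case: q'in => [->|->]; rewrite ?eqxx ?orbT.
- by move=> a /q'x/xq/qp.
- rewrite inE => /orP[/eqP->|/q'min//] xq'.
  by apply/seteqP; split.
Qed.

(** If a product of primes over [I] is contained in [I], every prime over [I]
    contains one of them, so it suffices to go down to a minimal one. *)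
Lemma minimal_prime_exists I p : ideal I -> Vset I p ->
  exists2 q, minimal_prime_divisors I q & q `<=` p.
Proof.
move=> idI Vp; have [Ps [VPs PsI]] := exists_prime_products idI.
have [q [qin qp qmin]] := minimal_below Ps p.
have Vq : Vset I q by case: qin => [->|/VPs].
exists q => //; split=> // r [prr Ir] rq.
have [|P Pin Pr] := @sub_prime_products Ps r prr; first by move=> c /PsI/Ir.
have Pq : P = q by apply: qmin => // a /Pr/rq.
by apply/seteqP; split=> //; rewrite -Pq.
Qed.

Lemma finite_minimal_primes I : ideal I ->
  finite_set (minimal_prime_divisors I).
Proof.
move=> idI; have [Ps [VPs PsI]] := exists_prime_products idI.
apply: sub_finite_set (finite_seq Ps) => q [[prq Iq] qmin] /=.
have [|P Pin Pq] := @sub_prime_products Ps q prq; first by move=> c /PsI/Iq.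
by rewrite -(qmin P (VPs P Pin) Pq).
Qed.

(** An ideal that is maximal among the proper ideals containing [I] is a maximal
    ideal, hence is [m]. *)
Lemma proper_sub_local (m : idealr R) I : is_local m -> ideal I -> ~ I 1 ->
  I `<=` [set` m].
Proof.
move=> [_ uniqm] idI nI1.
have [N [idN nN1 IN] maxN] := @noetherian_max R noethR
  [set J | [/\ ideal J, ~ J 1 & I `<=` J]] (fun J h => let: And3 x _ _ := h in x)
  (ex_intro _ I (And3 idI nI1 (@subset_refl _ I))).
have [n nE] := idealr_of idN nN1; rewrite nE in maxN IN.
rewrite -(uniqm n) // => J nJ; apply/seteqP; split=> //; apply: maxN => //.
split; [exact: idealr_ideal|by rewrite /= idealr1|by move=> a /IN/nJ].
Qed.

End NoetherianPrimes.

(** * Associated primes and support *)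

Section AssociatedPrimes.
Variables (R : comNzRingType) (M : lmodType R).
Hypothesis noethR : noetherian R.
Implicit Types (p q : set R) (x y : M).

Lemma Ann_ideal (A : set M) : ideal (Ann A).
Proof.
split=> [x _|a b aA bA x Ax|c a aA x Ax]; first by rewrite scale0r.
  by rewrite scalerDl aA // bA // addr0.
by rewrite -scalerA aA // scaler0.
Qed.

Lemma Ann1E x a : Ann [set x] a <-> a *: x = 0.
Proof. by split=> [->//|ax0 _ ->]. Qed.

Lemma sub_Ann (A B : set M) : A `<=` B -> Ann B `<=` Ann A.
Proof. by move=> AB a aB x /AB/aB. Qed.

(** [(Ann x : c)] is the annihilator of [c *: x]. *)
Lemma Ass_below x p : is_prime p -> Ann [set x] `<=` p ->
  exists2 q, Ass M q & q `<=` p.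
Proof.
move=> prp xp; have [c [prc cp]] := colon_prime noethR (Ann_ideal _) prp xp.
exists [set a | Ann [set x] (a * c)] => //; split=> //; exists (c *: x).
by apply/seteqP; split=> a /=; rewrite !Ann1E scalerA.
Qed.

Lemma Ass_Vset p : Ass M p -> Vset (Ann [set: M]) p.
Proof. by move=> [prp [x pE]]; split=> //; rewrite pE; apply: sub_Ann. Qed.

Lemma fraction_eq0 (P : prime_idealr R) x (s : denominator P) :
  \pi_(localization P M) (x, s) = 0 <->
  exists u : denominator P, sval u *: x = 0.
Proof.
have -> : 0 = \pi_(localization P M) (frac_zero P M).
  by rewrite loc_pi0.
split=> [/eqP/pi_fracP[u]|[u ux0]].
  by rewrite /= scale1r scaler0 subr0; exists u.
by apply/eqP/pi_fracP; exists u; rewrite /= scale1r scaler0 subr0.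
Qed.

Lemma SuppP p : Supp M p <-> is_prime p /\ exists x, Ann [set x] `<=` p.
Proof.
split=> [[P [-> [z znz]]]|[[P ->] [x xP]]].
  split; first by exists P.
  move: znz; rewrite -[z]reprK; case: (repr z) => x s /eqP xsnz; exists x => a.
  move/Ann1E => ax0; apply: contrapT => /negP naP; apply/xsnz/fraction_eq0.
  by exists (exist _ a naP).
exists P; split=> //; exists (\pi_(localization P M) (x, denominator1 P)).
by apply/eqP => /fraction_eq0[[u /negP uP] /= ux0]; apply/uP/xP/Ann1E.
Qed.

Lemma Supp_Vset : Supp M `<=` Vset (Ann [set: M]).
Proof.
by move=> p /SuppP[prp [x xp]]; split=> // a /(@sub_Ann [set x]) aM; apply/xp/aM.
Qed.

Lemma condSP : condS M <-> minimal_prime_divisors (Ann [set: M]) `<=` Ass M.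
Proof.
split=> [SM p [Vp minp]|minM].
  have /SuppP[prp [x xp]] : Supp M p by rewrite SM.
  have [q Assq qp] := Ass_below prp xp.
  by rewrite -(minp q (Ass_Vset Assq) qp).
apply/seteqP; split=> [|p Vp]; first exact: Supp_Vset.
have [q /minM[prq [x ->]] qp] := minimal_prime_exists noethR (Ann_ideal _) Vp.
by apply/SuppP; split; [case: Vp|exists x].
Qed.

(** A minimal prime divisor is of the form [(Ann M : c)], which is the
    annihilator of the submodule [c M]. *)
Lemma minimal_prime_Koatt :
  minimal_prime_divisors (Ann [set: M]) `<=` Koatt M.
Proof.
move=> p [[prp Mp] minp]; split=> //.
have [c [prc cp]] := colon_prime noethR (Ann_ideal _) prp Mp.
pose U : {pred M} := fun x => `[< exists y, x = c *: y >].
have clU : submod_closed U.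
  split=> [|a _ _ /asboolP[y ->] /asboolP[z ->]]; apply/asboolP.
    by exists 0; rewrite scaler0.
  by exists (a *: y + z); rewrite scalerDr !scalerA mulrC.
exists (HB.pack_for (submodClosed M) U (GRing.isSubmodClosed.Build R M U clU)).
rewrite -(minp _ _ cp); last first.
  by split=> // a aM x _ /=; rewrite mulrC -scalerA aM ?scaler0.
apply/seteqP; split=> a aU x /=.
  by move=> /asboolP[y ->]; rewrite scalerA; apply: aU.
by move=> _; rewrite -scalerA; apply: aU; apply/asboolP; exists x.
Qed.

Lemma condA_condS : condA M -> condS M.
Proof. by move=> AM; apply/condSP; rewrite AM; apply: minimal_prime_Koatt. Qed.

Lemma condS_condB : condS M -> condB M.
Proof.
move=> /condSP minM; exists (minimal_prime_divisors (Ann [set: M])).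
split; first exact/(finite_minimal_primes noethR)/Ann_ideal.
split=> // p /Ass_Vset; exact/(minimal_prime_exists noethR)/Ann_ideal.
Qed.

End AssociatedPrimes.

(** * Adic topology and completeness *)

Section AdicTopology.
Variables (R : comNzRingType) (I : set R).

Section Filtration.
Variable M : lmodType R.
Implicit Types (x y z : M) (s : nat -> M).

Lemma adic0 x : x \in adic I (M:=M) 0.
Proof.
apply/adicP; exists 1%N, (fun=> 1), (fun=> x).
by split=> //; rewrite big_ord1 scale1r.
Qed.

Lemma adic_mono n k : (n <= k)%N -> {subset adic I (M:=M) k <= adic I n}.
Proof.
move=> /subnK <-; elim: (k - n)%N => // d IHd x.
by rewrite addSn => /adicS/IHd.
Qed.

Lemma ideal_pow_adic n a x : ideal_pow I n a -> a *: x \in adic I n.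
Proof.
move=> Ia; apply/adicP; exists 1%N, (fun=> a), (fun=> x).
by split=> //; rewrite big_ord1.
Qed.

Definition adic_converging := forall s, (forall n, s n.+1 - s n \in adic I n) ->
  exists x, forall n, x - s n \in adic I n.

Lemma separatedP :
  separated I M <-> forall x, (forall n, x \in adic I n) -> x = 0.
Proof.
split=> [sepM x xI|sepM].
  have : (\bigcap_(n in [set n | (0 < n)%N]) [set` adic I (M:=M) n]) x.
    by move=> n _; apply: xI.
  by rewrite sepM.
apply/seteqP; split=> [x xI|_ -> n _]; last exact: rpred0.
by apply: sepM => -[|n]; [exact: adic0|exact: xI].
Qed.

Definition coord n (f : completion I M) : adic_quot I M n := sval f n.

Lemma coord_linear n : linear (coord n).
Proof. by []. Qed.

HB.instance Definition _ n := GRing.isLinear.Build R (completion I M)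
  (adic_quot I M n) _ (coord n) (coord_linear n).

Lemma coord_inj f g : (forall n, coord n f = coord n g) -> f = g.
Proof. by move=> fg; apply/val_inj/functional_extensionality_dep. Qed.

Lemma adic_trans_coord n f : adic_trans (coord n.+1 f) = coord n f.
Proof. by case: f => f fP; apply: (asboolP _ fP n). Qed.

Lemma coord_to_completion n x :
  coord n (to_completion I x) = \pi_(adic_quot I M n) x.
Proof. by []. Qed.

Lemma completion_of_coord (f : adic_prod I M) :
  (forall n, adic_trans (f n.+1) = f n) -> exists g, forall n, coord n g = f n.
Proof. by move=> /asboolP fP; exists (exist _ f fP). Qed.

Lemma adic_quot0 n : 0 = \pi_(adic_quot I M n) 0.
Proof. by rewrite -coord_to_completion !raddf0. Qed.

Lemma adic_quot_eq0 n x : (\pi_(adic_quot I M n) x == 0) = (x \in adic I n).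
Proof. by rewrite [X in _ == X]adic_quot0 quotmod_eqE subr0. Qed.

Lemma adic_quot_annihilated n a (q : adic_quot I M n) :
  ideal_pow I n a -> a *: q = 0.
Proof.
move=> Ia; rewrite -[q]reprK; apply: etrans (esym (quotmod_piZ _ _ _)) _.
by apply/eqP; rewrite adic_quot_eq0; apply: ideal_pow_adic.
Qed.

Lemma separated_inj : separated I M -> injective (@to_completion _ I M).
Proof.
move=> /separatedP sepM x y xy; apply/eqP; rewrite -subr_eq0; apply/eqP/sepM => n.
have xy0 : to_completion I (x - y) = 0.
  by rewrite raddfB; apply/eqP; rewrite subr_eq0; apply/eqP.
by rewrite -adic_quot_eq0 -coord_to_completion xy0 raddf0.
Qed.

Lemma complete_separated : complete I M -> separated I M.
Proof.
move=> [g gK _]; apply/separatedP => x xI; apply: (can_inj gK).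
rewrite raddf0; apply: coord_inj => n.
by rewrite coord_to_completion raddf0; apply/eqP; rewrite adic_quot_eq0; apply: xI.
Qed.

Lemma complete_converging : complete I M -> adic_converging.
Proof.
move=> [g _ gK] s sC.
have [|f fE] := @completion_of_coord (fun n => \pi_(adic_quot I M n) (s n)).
  by move=> n; rewrite adic_trans_pi; apply/eqP; rewrite quotmod_eqE.
by exists (g f) => n; rewrite -quotmod_eqE -fE -coord_to_completion gK.
Qed.

Lemma completeI : separated I M -> adic_converging -> complete I M.
Proof.
move=> sepM cvgM.
have /choice[g gK] : forall f : completion I M, exists x, to_completion I x = f.
  move=> f; have [|x xP] := cvgM (fun n => repr (coord n f)).
    by move=> n; rewrite -quotmod_eqE reprK; apply/eqP/adic_trans_coord.
  exists x; apply: coord_inj => n; rewrite coord_to_completion -[RHS]reprK.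
  by apply/eqP; rewrite quotmod_eqE.
by exists g => // x; apply: (separated_inj sepM); rewrite gK.
Qed.

End Filtration.

Hypothesis fgI : exists (d : nat) (t : 'I_d -> R),
  forall x, I x <-> exists c : 'I_d -> R, x = \sum_i c i * t i.

Lemma ideal_powZ n a c : ideal_pow I n a -> ideal_pow I n (c * a).
Proof.
elim: n a => // n IHn _ [k [b [y [Ib Iy ->]]]].
exists k, b, (fun i => c * y i); split=> // [i|]; first by apply/IHn/Iy.
by rewrite mulr_sumr; apply: eq_bigr => i _; rewrite /GRing.scale /=; ring.
Qed.

Lemma adic_generators (d : nat) (t : 'I_d -> R) (M : lmodType R) n (x : M) :
  (forall x, I x -> exists c : 'I_d -> R, x = \sum_i c i * t i) ->
  x \in adic I n.+1 ->
  exists e : 'I_d -> M, (forall i, e i \in adic I n) /\ x = \sum_i t i *: e i.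
Proof.
move=> tP /adicP[k [a [y [Ia _ ->]]]].
pose K (z : M) := exists e : 'I_d -> M,
  (forall i, e i \in adic I n) /\ z = \sum_i t i *: e i.
have K0 : K 0.
  exists (fun=> 0); split=> [i|]; first exact: rpred0.
  by rewrite big1 // => i _; rewrite scaler0.
have KD u v : K u -> K v -> K (u + v).
  move=> [e [eI ->]] [e' [e'I ->]]; exists (fun i => e i + e' i).
  split=> [i|]; first exact: rpredD.
  by rewrite -big_split; apply: eq_bigr => i _; rewrite scalerDr.
apply: (big_ind K) => // j _.
have [l [b [c [Ib Ic ->]]]] := Ia j.
rewrite scaler_suml; apply: (big_ind K) => // r _.
have [w ->] := tP _ (Ib r); exists (fun i => (w i * c r) *: y j).
split=> [i|]; first exact/ideal_pow_adic/ideal_powZ/Ic.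
rewrite [X in X *: y j]mulr_suml scaler_suml; apply: eq_bigr => i _.
by rewrite [RHS]scalerA; congr (_ *: _); ring.
Qed.

Section CoarserFiltration.
Variables (N : lmodType R) (F : nat -> submodClosed N).
Hypothesis adicF : forall n, {subset adic I (M:=N) n <= F n}.
Hypothesis FS : forall n, {subset F n.+1 <= F n}.
Hypothesis sepF : forall x, (forall n, x \in F n) -> x = 0.
Hypothesis cvgF : forall s : nat -> N, (forall n, s n.+1 - s n \in F n) ->
  exists x, forall n, x - s n \in F n.

(** Write each term [e n] as the sum of the [t_i *: u n i] with [u n i] in
    [I^(n+k) N].  The series of the [u n i] converges for [F], and by induction
    its sum [w i] is in [I^k N]; as [F] is separated, [z] is the sum of the
    [t_i *: w i]. *)
Lemma series_adic k (e : nat -> N) z : (forall n, e n \in adic I (n + k)) ->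
  (forall n, z - \sum_(j < n) e j \in F n) -> z \in adic I k.
Proof.
have [d [t tP]] := fgI.
elim: k e z => [|k IHk] e z eI zF; first exact: adic0.
have /choice[u uP] : forall n, exists v : 'I_d -> N,
    (forall i, v i \in adic I (n + k)) /\ e n = \sum_i t i *: v i.
  move=> n; apply: adic_generators => [x /tP//|].
  by rewrite -addnS.
have /choice[w wP] : forall i, exists x,
    forall n, x - \sum_(j < n) u j i \in F n.
  move=> i; apply: cvgF => n; rewrite big_ord_recr /= addrAC subrr add0r.
  by apply/adicF/adic_mono/(proj1 (uP n)); rewrite leq_addr.
have wI i : w i \in adic I k.
  by apply: (IHk (fun n => u n i)) => // n; case: (uP n).
have -> : z = \sum_i t i *: w i.
  apply/eqP; rewrite -subr_eq0; apply/eqP/sepF => n.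
  rewrite -[z](subrK (\sum_(j < n) e j)) -addrA rpredD //.
  rewrite (eq_bigr (fun j : 'I_n => \sum_i t i *: u j i)); last first.
    by move=> j _; case: (uP j).
  rewrite exchange_big /= -sumrB; apply: rpred_sum => i _.
  rewrite -scaler_sumr -scalerBr; apply: rpredZ.
  by rewrite -opprB -scaleN1r; apply/rpredZ/wP.
apply: rpred_sum => i _; have /adicP[l [a [y [Ia _ ->]]]] := wI i.
rewrite scaler_sumr; apply: rpred_sum => j _; rewrite scalerA.
apply: ideal_pow_adic; exists 1%N, (fun=> t i), (fun=> a j); split=> //.
- move=> _; apply/tP; exists (fun j => (j == i)%:R).
  rewrite (bigD1 i) //= eqxx mul1r big1 ?addr0 // => r /negPf->.
  by rewrite mul0r.
- by rewrite big_ord1.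
Qed.

(** If [x] is the limit of [s] for [F], then [x - s k] is the sum of the series of
    increments of [s] from [k] on, so it is in [I^k N] by [series_adic].  This
    applies to a closed submodule of a complete module, [F] being the trace of
    the filtration of the larger module. *)
Lemma complete_of_coarser : complete I N.
Proof.
apply: completeI.
  by apply/separatedP => x xI; apply: sepF => n; apply: adicF.
move=> s sC; have [x xP] : exists x, forall n, x - s n \in F n.
  by apply: cvgF => n; apply/adicF/sC.
have F_mono n k : {subset F (n + k)%N <= F n}.
  by elim: k => [|k IHk] y; rewrite ?addn0 // addnS => /FS/IHk.
exists x => k; apply: (@series_adic k (fun n => s (n + k).+1%N - s (n + k)%N)) => n.
  exact: sC.
rewrite (_ : \sum_(j < n) _ = s (n + k)%N - s k); last first.
  rewrite -(big_mkord xpredT (fun j => s (j + k).+1%N - s (j + k)%N)).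
  by rewrite (telescope_sumr (fun j => s (j + k)%N)) // add0n.
by rewrite opprB addrA subrK; apply/F_mono/xP.
Qed.

End CoarserFiltration.
End AdicTopology.

(** * The part of the completion killed by an ideal *)

Section Torsion.
Variables (R : comNzRingType) (I : set R) (M : lmodType R).

Definition torsion (L : lmodType R) (p : set R) : {pred L} :=
  fun x => `[< forall a, p a -> a *: x = 0 >].

Lemma torsion_submod (L : lmodType R) p : submod_closed (@torsion L p).
Proof.
split=> [|c x y /asboolP px /asboolP py]; apply/asboolP => a pa.
  exact: scaler0.
by rewrite scalerDr scalerA mulrC -scalerA px // py // scaler0 addr0.
Qed.

HB.instance Definition _ (L : lmodType R) p :=
  GRing.isSubmodClosed.Build R L (@torsion L p) (@torsion_submod L p).

Definition torsion_module (L : lmodType R) (p : set R) :=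
  {x : L | x \in torsion p}.
HB.instance Definition _ L p := Choice.on (torsion_module L p).
HB.instance Definition _ L p := SubChoice.on (torsion_module L p).
HB.instance Definition _ (L : lmodType R) p :=
  [SubChoice_isSubLmodule of torsion_module L p by <:].

Lemma torsion_moduleP (L : lmodType R) p (x : torsion_module L p) a :
  p a -> a *: val x = 0.
Proof. by have /asboolP := valP x; apply. Qed.

Lemma torsion_module_of (L : lmodType R) p (x : L) :
  (forall a, p a -> a *: x = 0) -> exists y : torsion_module L p, val y = x.
Proof. by move=> /asboolP px; exists (exist _ x px). Qed.

Lemma Ass_torsion_module (L : lmodType R) p :
  Ass (torsion_module L p) `<=` Ass L.
Proof.
move=> q [prq [x qE]]; split=> //; exists (val x); rewrite qE.
apply/seteqP; split=> a; rewrite !Ann1E.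
  by move=> ax0; apply: (congr1 val ax0).
by move=> ax0; apply: val_inj.
Qed.

Hypothesis fgI : exists (d : nat) (t : 'I_d -> R),
  forall x, I x <-> exists c : 'I_d -> R, x = \sum_i c i * t i.

Section TorsionOfCompletion.
Variable p : set R.
Local Notation N := (torsion_module (completion I M) p).

(** The trace on [N] of the natural filtration of the completion, for which
    completeness and closedness under limits are immediate; it can be strictly
    coarser than the adic filtration of [N]. *)
Definition coord_ker n : {pred N} := fun f => coord n (val f) == 0.

Lemma coord_ker_submod n : submod_closed (coord_ker n).
Proof.
split=> [|a f g /eqP f0 /eqP g0]; apply/eqP; first by rewrite !raddf0.
by rewrite !linearP /= f0 g0 scaler0 addr0.
Qed.

HB.instance Definition _ n :=
  GRing.isSubmodClosed.Build R N (coord_ker n) (coord_ker_submod n).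

Lemma coord_kerB (f g : N) n :
  f - g \in coord_ker n <-> coord n (val f) = coord n (val g).
Proof.
split=> [/eqP|fg]; [|apply/eqP]; rewrite !raddfB /=; first by move/subr0_eq.
by rewrite fg subrr.
Qed.

Lemma complete_torsion_completion : complete I N.
Proof.
apply: (complete_of_coarser fgI (F := coord_ker)).
- move=> n f /adicP[k [a [y [Ia _ ->]]]]; apply: rpred_sum => i _; apply/eqP.
  by rewrite !linearZ /= (adic_quot_annihilated _ (Ia i)).
- move=> n f /eqP f0; apply/eqP; rewrite -adic_trans_coord f0.
  by rewrite adic_quot0 adic_trans_pi -adic_quot0.
- move=> f f0; apply/val_inj/coord_inj => n.
  by rewrite !raddf0; apply/eqP/f0.
- move=> s sC.
  have [|f fE] := @completion_of_coord _ I M (fun n => coord n (val (s n))).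
    by move=> n; rewrite adic_trans_coord; apply/coord_kerB/sC.
  have [|y yE] := @torsion_module_of _ p f.
    move=> a pa; apply: coord_inj => n.
    rewrite linearZ raddf0 /= fE.
    by have := congr1 (coord n) (torsion_moduleP (s n) pa); rewrite linearZ raddf0.
  by exists y => n; apply/coord_kerB; rewrite yE fE.
Qed.

Lemma Ann_torsion_completion (U : submodClosed M) :
  separated I M -> p = Ann [set` U] -> Ann [set: N] = p.
Proof.
move=> sepM pU; apply/seteqP; split=> a.
  move=> aN; rewrite pU => x Ux; apply: (separated_inj sepM).
  have [|y yE] := @torsion_module_of _ p (to_completion I x).
    by move=> b; rewrite pU -linearZ => /(_ x Ux) /= ->; rewrite raddf0.
  rewrite linearZ raddf0 /= -yE.
  by have := congr1 val (aN y Logic.I); rewrite linearZ raddf0.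
by move=> pa f _; apply: val_inj; rewrite linearZ raddf0; apply: torsion_moduleP.
Qed.

End TorsionOfCompletion.
End Torsion.

(** * Complete modules with finitely many minimal associated primes *)

Section Baire.
Variables (R : comNzRingType) (I : set R) (M : lmodType R).

(** Baire: [M] is the union over [n] of the closed submodules killed by [c^n].
    If none of them were open, one could build a Cauchy sequence [s] together
    with radii [k_j] such that no [y] in [s_(j+1) + I^(k_(j+1)) M] is
    killed by [c^j]; its limit would be killed by no power of [c]. *)
Lemma complete_torsion_bounded c : complete I M ->
  (forall x : M, exists n, c ^+ n *: x = 0) ->
  exists n k, forall x : M, x \in adic I k -> c ^+ n *: x = 0.
Proof.
move=> cM torM; apply: contrapT => unbounded.
have sepM := (separatedP I M).1 (complete_separated cM).
have step (jq : nat * (M * nat)) : exists q : M * nat,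
    [/\ q.1 - jq.2.1 \in adic I jq.2.2, (jq.2.2 < q.2)%N
      & c ^+ jq.1 *: q.1 \notin adic I q.2].
  case: jq => j [x k] /=.
  have [y yk ynz] : exists2 y, y - x \in adic I k & c ^+ j *: y <> 0.
    have [x0|] := pselect (c ^+ j *: x = 0); last first.
      by exists x => //; rewrite subrr; apply: rpred0.
    apply: contrapT => noy; apply: unbounded; exists j, k => z zk.
    apply: contrapT => znz; apply: noy; exists (z + x); first by rewrite addrK.
    by rewrite scalerDr x0 addr0.
  have [l yl] : exists l, c ^+ j *: y \notin adic I l.
    apply: contrapT => noyl; apply/ynz/sepM => l.
    by apply/negPn/negP => yl; apply: noyl; exists l.
  exists (y, maxn l k.+1); split=> //=; first exact: leq_maxr.
  by apply: contra yl; apply: adic_mono; apply: leq_maxl.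
have [f fP] := choice step.
pose s := fix s j := if j is i.+1 then f (i, s i) else ((0 : M), 0%N).
have sI j : (s j.+1).1 - (s j).1 \in adic I (s j).2 by case: (fP (j, s j)).
have slt j : ((s j).2 < (s j.+1).2)%N by case: (fP (j, s j)).
have sge j : (j <= (s j).2)%N.
  by elim: j => // j IHj; apply: leq_ltn_trans (slt j).
have [x xP] : exists x, forall j, x - (s j).1 \in adic I j.
  by apply: (complete_converging cM) => j; apply: adic_mono (sI j).
have [n xn] := torM x.
have [_ _ /negP] := fP (n, s n); rewrite -/(s n.+1) /=; apply.
set k := (s n.+1).2.
have smono d : (k <= (s (n.+1 + d)%N).2)%N.
  by elim: d => [|d IHd]; rewrite ?addn0 // addnS; apply/(leq_trans IHd)/ltnW.
have stail d : (s (n.+1 + d)%N).1 - (s n.+1).1 \in adic I k.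
  elim: d => [|d IHd]; first by rewrite addn0 subrr; apply: rpred0.
  rewrite addnS -[(s (n.+1 + d).+1%N).1](subrK (s (n.+1 + d)%N).1) -addrA.
  by apply: rpredD => //; apply: adic_mono (sI _).
have xk : x - (s n.+1).1 \in adic I k.
  rewrite -[x](subrK (s (n.+1 + k)%N).1) -addrA; apply: rpredD => //.
  by apply: adic_mono (xP _); apply: leq_addl.
have -> : c ^+ n *: (s n.+1).1 = (- c ^+ n) *: (x - (s n.+1).1).
  by rewrite scalerBr !scaleNr xn oppr0 sub0r opprK.
exact: rpredZ.
Qed.

Lemma ideal_powX a n : I a -> ideal_pow I n (a ^+ n).
Proof.
move=> Ia; elim: n => // n IHn; exists 1%N, (fun=> a), (fun=> a ^+ n).
by split=> //; rewrite big_ord1 exprS.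
Qed.

End Baire.

Lemma prime_avoid_finite (R : comNzRingType) (p : set R) (s : seq (set R)) :
  is_prime p -> (forall q, q \in s -> ideal q /\ ~ q `<=` p) ->
  exists2 c, ~ p c & forall q, q \in s -> q c.
Proof.
move=> /is_primeP[_ np1 pM]; elim: s => [|q s IHs] sP; first by exists 1.
have [|c npc sc] := IHs; first by move=> r rs; apply: sP; rewrite inE rs orbT.
have [idq /existsNP[b /not_implyP[qb npb]]] := sP q (mem_head _ _).
exists (b * c) => [/pM[]//|r]; rewrite inE => /orP[/eqP->|rs].
  by rewrite mulrC; apply: idealZ.
apply: idealZ; last exact: sc.
by case: (sP r) => //; rewrite inE rs orbT.
Qed.

Section CompleteModules.
Variables (R : comNzRingType) (m : idealr R).
Hypotheses (noethR : noetherian R) (localR : is_local m).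

(** In the case [p = m] left by Baire's argument, the annihilator of any nonzero
    element lies in [m], because the ring is local. *)
Lemma complete_condB_condS (M : lmodType R) :
  complete [set` m] M -> condB M -> condS M.
Proof.
move=> cM [F [/finite_seqP[s FE] [FAss Ffinal]]]; apply/(condSP M noethR).
rewrite {}FE in FAss Ffinal => p [[prp Mp] minp]; apply: contrapT => nAssp.
have sP q : q \in s -> ideal q /\ ~ q `<=` p.
  move=> /FAss Assq; split; first by case: Assq => /prime_ideal.
  by move=> qp; apply: nAssp; rewrite -(minp q (Ass_Vset Assq) qp).
have [c npc sc] := prime_avoid_finite prp sP.
have torM (x : M) : exists n, c ^+ n *: x = 0.
  have [Ps [VPs Psx]] := exists_prime_products noethR (Ann_ideal [set x]).
  exists (size Ps); apply/Ann1E/Psx; move: VPs {Psx}.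
  elim: Ps => // P Ps IHPs VPs.
  exists c, (c ^+ size Ps); split; last exact: exprS.
    have [prP xP] := VPs P (mem_head _ _).
    have [q Assq qP] := Ass_below noethR prP xP.
    by have [r /sc rc rq] := Ffinal q Assq; apply/qP/rq.
  by apply: IHPs => Q Qin; apply: VPs; rewrite inE Qin orbT.
have [n [k ck]] := complete_torsion_bounded cM torM.
have [idp np1 pM] := (is_primeP p).1 prp.
have mp : [set` m] `<=` p.
  move=> a ma; apply: (primeX (n := k) prp).
  have : p (c ^+ n * a ^+ k).
    apply: Mp => x _; rewrite -scalerA; apply/ck/ideal_pow_adic.
    exact: (ideal_powX (I := [set` m])).
  by case/pM => // /(primeX prp).
have pE : p = [set` m].
  have [P PE] := idealr_of idp np1; rewrite PE in mp *.
  exact: (localR.1 P).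
have [x xnz] : exists x : M, x <> 0.
  apply: contrapT => M0; apply/np1/Mp => x _; rewrite scale1r.
  by apply: contrapT => xnz; apply: M0; exists x.
have xp : Ann [set x] `<=` p.
  rewrite pE; apply: proper_sub_local => //; first exact: Ann_ideal.
  by move/Ann1E; rewrite scale1r.
have [q Assq qp] := Ass_below noethR prp xp.
by apply: nAssp; rewrite -(minp q (Ass_Vset Assq) qp).
Qed.

Lemma Ass_complete (M : lmodType R) : complete [set` m] M ->
  Ass (completion [set` m] M) `<=` Ass M.
Proof.
move=> cM p [prp [f pE]]; split=> //; have [g _ gK] := cM.
exists (g f); rewrite pE.
have inj := separated_inj (complete_separated cM).
apply/seteqP; split=> a; rewrite !Ann1E => af0.
  by apply: inj; rewrite linearZ raddf0 /= gK.
by rewrite -[f]gK -linearZ /= af0 raddf0.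
Qed.

Lemma Ass_Koatt (M : lmodType R) : Ass M `<=` Koatt M.
Proof.
move=> p [prp [x pE]]; split=> //.
pose U : {pred M} := fun y => `[< exists c, y = c *: x >].
have clU : submod_closed U.
  split=> [|a _ _ /asboolP[c ->] /asboolP[d ->]]; apply/asboolP.
    by exists 0; rewrite scale0r.
  by exists (a * c + d); rewrite scalerDl scalerA.
exists (HB.pack_for (submodClosed M) U (GRing.isSubmodClosed.Build R M U clU)).
rewrite pE; apply/seteqP; split=> a.
  move/Ann1E => ax0 y /asboolP[c ->].
  by rewrite scalerA mulrC -scalerA ax0 scaler0.
by move=> aU; apply/Ann1E/aU/asboolP; exists 1; rewrite scale1r.
Qed.

(** Condition (S) is applied to the part of the completion killed by [p]: its
    annihilator is [p], which is thus its own minimal prime divisor. *)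
Lemma Koatt_sub_Ass_completion :
  (forall M : lmodType R, complete [set` m] M -> condS M) ->
  forall M : lmodType R, separated [set` m] M ->
    Koatt M `<=` Ass (completion [set` m] M).
Proof.
move=> SR M sepM p [prp [U pU]].
have fgm := noetherian_fg noethR (idealr_ideal m).
have SN := SR _ (complete_torsion_completion M fgm p).
apply: (@Ass_torsion_module _ _ p); apply: (condSP _ noethR).1 SN _ _.
rewrite (Ann_torsion_completion sepM pU); split; first by split.
by move=> q [_ pq] qp; apply/seteqP; split.
Qed.

End CompleteModules.

(** * The theorem *)

Theorem mainTheorem5 (R : comNzRingType) (m : idealr R)
    (noethR : noetherian R) (localR : is_local m) :
  (forall M : lmodType R,
     [/\ condS M <-> minimal_prime_divisors (Ann [set: M]) `<=` Ass M,
         condA M -> condS M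
       & condS M -> condB M]) /\
  ((forall M : lmodType R, complete [set` m] M -> condB M) ->
   forall M : lmodType R, complete [set` m] M -> condA M) /\
  ((forall M : lmodType R, complete [set` m] M -> condS M) <->
   (forall M : lmodType R, separated [set` m] M ->
      Koatt M `<=` Ass (completion [set` m] M))).
Proof.
split; [|split; [|split]].
- move=> M; split; [exact: condSP|exact: condA_condS|exact: condS_condB].
- move=> BR M cM; apply/seteqP; split; first exact: Ass_Koatt.
  move=> p Kp; apply: (Ass_complete cM).
  apply: (Koatt_sub_Ass_completion noethR _ (complete_separated cM) Kp).
  by move=> N cN; apply: (complete_condB_condS noethR localR cN (BR N cN)).
- exact: Koatt_sub_Ass_completion.
- move=> KR M cM; apply/(condSP M noethR) => p minp.
  apply/(Ass_complete cM)/(KR _ (complete_separated cM)).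
  exact: minimal_prime_Koatt minp.
Qed.
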